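(* Let $n\geq 600$ be an integer. The unique graph on $2n+1$ vertices with at least $n^2+n$ edges that does not contain two vertices of the same degree joined by a path of length three is the complete bipartite graph $K_{n,n+1}$.
   Context: All graphs are finite and simple. A path of length three is a path with three edges (on four distinct vertices); two vertices are joined by a path of length three if they are the two endpoints of such a path. The degree of a vertex is its number of neighbours. *)

(* Defs.v *)
From HB Require Import structures.
From mathcomp Require Import all_boot.

Set Implicit Arguments.
Unset Strict Implicit.
Unset Printing Implicit Defensive.

Record sgraph := SGraph {
  vertex :> finType;
  adj : rel vertex;
  adj_sym : symmetric adj;
  adj_irrefl : irreflexive adj
}.

Definition edges (G : sgraph) : {set {set G}} :=
  [set [set p.1; p.2] | p : G * G & adj p.1 p.2].

Definition degree (G : sgraph) (x : G) : nat := #|[set y | adj x y]|.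

Definition joined_by_path3 (G : sgraph) (x y : G) : Prop :=
  exists a b : G,
    [/\ uniq [:: x; a; b; y], adj x a, adj a b & adj b y].

Definition has_equal_degree_path3 (G : sgraph) : Prop :=
  exists x y : G, degree x = degree y /\ joined_by_path3 x y.

Definition isomorphic (G H : sgraph) : Prop :=
  exists2 f : G -> H, bijective f & forall x y : G, adj (f x) (f y) = adj x y.

Definition Kadj (m n : nat) : rel ('I_m + 'I_n)%type := fun x y =>
  match x, y with
  | inl _, inr _ | inr _, inl _ => true
  | _, _ => false
  end.

Lemma Kadj_sym m n : symmetric (@Kadj m n).
Proof. by move=> [x|x] [y|y]. Qed.

Lemma Kadj_irrefl m n : irreflexive (@Kadj m n).
Proof. by move=> [x|x]. Qed.

Definition complete_bipartite (m n : nat) : sgraph :=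
  SGraph (@Kadj_sym m n) (@Kadj_irrefl m n).

(* Main.v *)
From Stdlib Require Import ZArith.
Require Import Defs.
From mathcomp Require Import all_boot.
From mathcomp Require Import zify.

Set Implicit Arguments.
Unset Strict Implicit.
Unset Printing Implicit Defensive.

(** The only consequence of the hypothesis on paths that is used is local: if
    [x y] is an edge, [a] is a neighbour of [x] other than [y], [b] is a neighbour of
    [y] other than [x], and [a], [b] have the same degree, then [a = b].

    Let [M] be the set of vertices whose degree is shared, [mu = #|M|], and let
    [K] be the set of the other [k] vertices, whose degrees are pairwise
    distinct.  Since a degree class with at least two vertices essentially meets
    the neighbourhood of only one end of an edge, the ends of an edge have
    together at most [mu] neighbours in [M]; the exceptions come from degree
    classes that are cliques, and they are paid for class by class.  As in
    Mantel's theorem, if [D] is the maximal number of neighbours in [M] and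
    [A = 2 D - mu], then the degree sum inside [M] is at most
    [2 D (mu - D) + A + 1].  In [K], a vertex [w] of maximal degree bounds the
    degree sum (the degrees are distinct) as well as the number of edges to [M]
    (each neighbour of [w] in [K] has at most [mu - p] neighbours in [M], where
    [p] is the number of neighbours of [w] in [M]).  Adding up,
    [4 e <= N^2 - k - (A - 2)^2 + 6], or a similar bound when [A > k].

    As [4 e >= N^2 - 1], both [k] and [A] are bounded and every degree is within
    a constant of [N / 2].  The common neighbours of the ends of an edge have
    distinct degrees, so there are boundedly many; three neighbourhoods of
    size about [N / 2] with small pairwise intersections do not fit into [N]
    vertices, hence there is no triangle and Mantel's theorem applies. *)

(** * Graphs without equally coloured ends of a path of length three *)

Section ColouredGraph.

Variables (T I : finType) (e : rel T) (f : T -> I).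
Hypothesis e_sym : symmetric e.
Hypothesis e_irr : irreflexive e.
Hypothesis no_path : forall x y a b, e x y -> e x a -> e y b -> a != y ->
  b != x -> f a = f b -> a = b.

Definition cls (i : I) : {set T} := [set v | f v == i].
Definition repeated : {set T} := [set v | 1 < #|cls (f v)|].
Definition clique_class (i : I) : bool :=
  (1 < #|cls i|) && [forall u in cls i, forall v in cls i, (u != v) ==> e u v].
(* Without the edges inside clique classes, the ends of an edge have together at
   most [mu] repeated neighbours, without exception: see [tdeg_thin]. *)
Definition thin : rel T :=
  fun u v => e u v && ~~ ((f u == f v) && clique_class (f u)).
Definition rdeg (v : T) : nat := #|[set y in repeated | e v y]|.
Definition tdeg (v : T) : nat := #|[set y in repeated | thin v y]|.
Definition cdeg (v : T) (i : I) : nat := #|[set y in cls i | thin v y]|.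

Local Notation M := repeated.
Local Notation mu := #|repeated|.

Lemma thin_sym : symmetric thin.
Proof.
move=> u v; rewrite /thin e_sym; congr (_ && ~~ _).
by rewrite eq_sym; case: eqP => // ->.
Qed.

Lemma thinW u v : thin u v -> e u v. Proof. by case/andP. Qed.

Lemma e_neq u v : e u v -> u != v.
Proof. by apply: contraTneq => ->; rewrite e_irr. Qed.

Lemma clique_classP i u v : clique_class i -> f u = i -> f v = i -> u != v ->
  e u v.
Proof.
case/andP=> _ /forall_inP H fu fv uv.
have /forall_inP/(_ v) := H u (ltac:(by rewrite inE fu)).
by rewrite inE fv eqxx => /(_ isT); rewrite uv.
Qed.

Lemma sum_repeated (F : T -> nat) :
  \sum_(v in M) F v = \sum_(i | 1 < #|cls i|) \sum_(v in cls i) F v.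
Proof.
rewrite (partition_big f (fun i => 1 < #|cls i|)) /=; last by move=> v; rewrite inE.
apply: eq_bigr => i hi; apply: eq_bigl => v; rewrite !inE.
by case: eqP => [->|]; rewrite ?andbF ?hi.
Qed.

Lemma card_repeated : mu = \sum_(i | 1 < #|cls i|) #|cls i|.
Proof.
rewrite -sum1_card sum_repeated; apply: eq_bigr => i _.
by rewrite sum1_card.
Qed.

Lemma tdegE v : tdeg v = \sum_(i | 1 < #|cls i|) cdeg v i.
Proof.
rewrite /tdeg -sum1_card.
rewrite (eq_bigl (fun y => (y \in M) && thin v y)); last by move=> y; rewrite !inE.
rewrite big_mkcondr sum_repeated; apply: eq_bigr => i _.
rewrite -big_mkcondr /cdeg -sum1_card.
by apply: eq_bigl => y; rewrite !inE.
Qed.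

Lemma cls_card_ge (s : seq T) i : uniq s -> {subset s <= cls i} ->
  size s <= #|cls i|.
Proof.
by move=> us sub; rewrite cardE; apply: uniq_leq_size => // y /sub; rewrite mem_enum.
Qed.

Lemma cls_full (s : seq T) i : uniq s -> {subset s <= cls i} ->
  #|cls i| <= size s -> cls i =i s.
Proof.
move=> us sub hs y; rewrite -mem_enum.
have sub' : {subset s <= enum (cls i)} by move=> z /sub; rewrite mem_enum.
by case: (uniq_min_size us sub'); rewrite -?cardE // => _ ->.
Qed.

Lemma clique_class_seq (s : seq T) i : uniq s -> {subset s <= cls i} ->
  1 < size s -> #|cls i| <= size s ->
  {in s &, forall u v, u != v -> e u v} -> clique_class i.
Proof.
move=> us sub h1 hs he; apply/andP; split.
  by apply: leq_trans (cls_card_ge us sub).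
have E := cls_full us sub hs.
apply/forall_inP => u; rewrite E => hu; apply/forall_inP => v; rewrite E => hv.
by apply/implyP => /he; apply.
Qed.

(** If each end has a further thin neighbour in the class, [no_path] makes this one common vertex
    [a], so the counts add up to 2 plus the number of ends in the class. The class can be too small
    for that only if it consists of [a] and at least one end; then it is a clique class with a thin
    edge inside, which is impossible. *)
Lemma cdeg_thin u w i : thin u w -> 1 < #|cls i| ->
  cdeg u i + cdeg w i <= #|cls i|.
Proof.
move=> tuw si.
have euw := thinW tuw; have ewu : e w u by rewrite e_sym.
have nuw := e_neq euw.
rewrite /cdeg; set A := [set y in _ | thin u y]; set B := [set y in _ | thin w y].
(* If [u'] has no thin neighbour in the class except perhaps [w'], then [w'], when it lies in the
   class, is missing from its own neighbourhood and makes up for it. *)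
have key (u' w' : T) (A' := [set y in cls i | thin u' y])
  (B' := [set y in cls i | thin w' y]) :
  A' :\ w' = set0 -> #|A'| + #|B'| <= #|cls i|.
  move=> A0.
  have hB : B' \subset cls i :\ w'.
    apply/subsetP=> y; rewrite !inE => /andP[-> /thinW /e_neq].
    by rewrite eq_sym => ->.
  have := subset_leq_card hB; rewrite (cardsD1 w' A') A0 cards0 (cardsD1 w' (cls i)).
  have : (w' \in A') <= (w' \in cls i) by rewrite !inE; case: (f w' == i) => //=; rewrite leq_b1.
  lia.
have [A0|[a ha]] := set_0Vmem (A :\ w); first exact: key A0.
have [B0|[b hb]] := set_0Vmem (B :\ u); first by rewrite addnC; exact: key B0.
have hab a' b' : a' \in A :\ w -> b' \in B :\ u -> a' = b'.
  rewrite !inE => /and3P[aw /eqP fa /thinW ua] /and3P[bu /eqP fb /thinW wb].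
  by apply: (no_path euw ua wb aw bu); rewrite fa fb.
have eb := hab _ _ ha hb; subst b.
have A1 : A :\ w = [set a].
  by apply/setP=> y; rewrite inE; apply/idP/eqP => [hy|->//]; apply: hab hb.
have B1 : B :\ u = [set a].
  by apply/setP=> y; rewrite inE; apply/idP/eqP => [hy|->//]; rewrite (hab _ _ ha hy).
rewrite (cardsD1 w A) (cardsD1 u B) A1 B1 !cards1.
move: ha hb; rewrite !inE => /and3P[aw /eqP fa tua] /and3P[au _ twa].
rewrite tuw thin_sym tuw !andbT.
have eua := thinW tua; have ewa := thinW twa.
have [fu|fu] := eqVneq (f u) i; have [fw|fw] := eqVneq (f w) i => /=.
- rewrite leqNgt; apply/negP => hlt.
  have/clique_class_seq bad : uniq [:: u; w; a].
    by rewrite /= !inE negb_or nuw (eq_sym u a) au (eq_sym w a) aw.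
  have {}bad : clique_class i.
    apply: bad => //.
      by move=> y; rewrite !inE => /or3P[] /eqP->; rewrite ?fu ?fw ?fa.
    move=> y z; rewrite !inE => /or3P[] /eqP-> /or3P[] /eqP->; rewrite ?eqxx //.
    - by rewrite e_sym.
    - by rewrite e_sym.
  by move: tuw; rewrite /thin fu fw eqxx bad andbF.
- rewrite leqNgt; apply/negP => hlt.
  have/clique_class_seq bad : uniq [:: u; a] by rewrite /= !inE eq_sym au.
  have {}bad : clique_class i.
    apply: bad => //.
      by move=> y; rewrite !inE => /orP[] /eqP->; rewrite ?fu ?fa.
    by move=> y z; rewrite !inE => /orP[] /eqP-> /orP[] /eqP->; rewrite ?eqxx // e_sym.
  by move: tua; rewrite /thin fu fa eqxx bad andbF.
- rewrite leqNgt; apply/negP => hlt.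
  have/clique_class_seq bad : uniq [:: w; a] by rewrite /= !inE eq_sym aw.
  have {}bad : clique_class i.
    apply: bad => //.
      by move=> y; rewrite !inE => /orP[] /eqP->; rewrite ?fw ?fa.
    by move=> y z; rewrite !inE => /orP[] /eqP-> /orP[] /eqP->; rewrite ?eqxx // e_sym.
  by move: twa; rewrite /thin fw fa eqxx bad andbF.
- by [].
Qed.

Lemma tdeg_thin u w : thin u w -> tdeg u + tdeg w <= mu.
Proof.
move=> tuw; rewrite !tdegE card_repeated -big_split /=.
by apply: leq_sum => i; apply: cdeg_thin.
Qed.

(** * Clique classes *)

Lemma cdeg_clique v i : f v = i -> clique_class i -> cdeg v i = 0.
Proof.
move=> fv bad; apply/eqP; rewrite cards_eq0; apply/eqP/setP=> y.
rewrite !inE /thin fv bad andbT eq_sym.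
by case: eqP; rewrite ?andbF.
Qed.

(** Vertices of class [j] differ from [u] and [z], so [no_path] along the edge [u z] applies without
    exception: if both neighbourhoods in [j] are nonempty, they are the same singleton. *)
Lemma cdeg_clique_pair u z i j : clique_class i -> f u = i -> f z = i -> u != z ->
  1 < #|cls j| -> j != i -> cdeg u j + cdeg z j <= #|cls j|.
Proof.
move=> bad fu fz uz sj ji.
have euz := clique_classP bad fu fz uz.
rewrite /cdeg; set A := [set y in _ | thin u y]; set B := [set y in _ | thin z y].
have hab a b : a \in A -> b \in B -> a = b.
  rewrite !inE => /andP[/eqP fa /thinW ua] /andP[/eqP fb /thinW wb].
  apply: (no_path euz ua wb); last by rewrite fa fb.
  - by apply: contraNneq ji => az; rewrite -fa az fz.
  - by apply: contraNneq ji => az; rewrite -fb az fu.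
have sA : #|A| <= #|cls j| by apply/subset_leq_card/subsetP=> y; rewrite inE => /andP[].
have sB : #|B| <= #|cls j| by apply/subset_leq_card/subsetP=> y; rewrite inE => /andP[].
have [->|[a ha]] := set_0Vmem A; first by rewrite cards0.
have [->|[b hb]] := set_0Vmem B; first by rewrite cards0 addn0.
have : A \subset [set b] by apply/subsetP=> y hy; rewrite inE (hab _ _ hy hb).
have : B \subset [set a] by apply/subsetP=> y hy; rewrite inE (hab _ _ ha hy).
move/subset_leq_card; rewrite cards1 => h1 /subset_leq_card; rewrite cards1; lia.
Qed.

Lemma tdeg_clique_pair u z i : clique_class i -> f u = i -> f z = i -> u != z ->
  tdeg u + tdeg z + #|cls i| <= mu.
Proof.
move=> bad fu fz uz; have si : 1 < #|cls i| by case/andP: bad.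
rewrite !tdegE card_repeated -big_split /= (bigD1 i) //= [leqRHS](bigD1 i) //=.
rewrite !cdeg_clique // addnC leq_add2l.
by apply: leq_sum => j /andP[sj ji]; apply: cdeg_clique_pair ji.
Qed.

(** Otherwise [u], [y], [v], [w] is a path of length three with equally coloured ends. *)
Lemma clique_class_nbr i y u v w : clique_class i -> f u = i -> f v = i ->
  f w = i -> u != v -> u != w -> v != w -> e y u -> e y v -> y = w.
Proof.
move=> bad fu fv fw uv uw vw yu yv.
apply/eqP/negPn/negP => yw.
have evw := clique_classP bad fv fw vw.
have/eqP := no_path yv yu evw uv (ltac:(by rewrite eq_sym)) (ltac:(by rewrite fu fw)).
by rewrite (negbTE uw).
Qed.

(** A fourth vertex would be adjacent to two of the other three, hence equal to the third by
    [clique_class_nbr]. *)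
Lemma card_clique_class i : clique_class i -> #|cls i| <= 3.
Proof.
move=> bad; rewrite leqNgt; apply/negP; rewrite cardE.
have : {subset enum (cls i) <= cls i} by move=> y; rewrite mem_enum.
case: (enum _) (enum_uniq (mem (cls i))) => [|u [|v [|w [|z s]]]] //= us sub _.
have F y : y \in [:: u, v, w, z & s] -> f y = i by move/sub; rewrite inE => /eqP.
move: us; rewrite !inE !negb_or => /and5P[/and4P[uv uw uz _] /and3P[vw vz _]
  /andP[wz _] _ _].
have fu := F u (ltac:(by rewrite !inE eqxx)).
have fv := F v (ltac:(by rewrite !inE eqxx ?orbT)).
have fw := F w (ltac:(by rewrite !inE eqxx ?orbT)).
have fz := F z (ltac:(by rewrite !inE eqxx ?orbT)).
have ezu : e z u by apply: (clique_classP bad) => //; rewrite eq_sym.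
have ezv : e z v by apply: (clique_classP bad) => //; rewrite eq_sym.
have := clique_class_nbr bad fu fv fw uv uw vw ezu ezv.
by move/eqP; rewrite eq_sym (negbTE wz).
Qed.

Lemma clique_class_nbr1 i y : clique_class i -> 2 < #|cls i| -> f y != i ->
  #|[set v in cls i | thin y v]| <= 1.
Proof.
move=> bad s3 fy; apply/card_le1_eqP => u v; rewrite !inE.
move=> /andP[/eqP fu /thinW yu] /andP[/eqP fv /thinW yv].
apply/eqP/negPn; rewrite eq_sym; apply/negP => uv.
have : 0 < #|cls i :\ u :\ v|.
  move: s3; rewrite (cardsD1 u) (cardsD1 v (cls i :\ u)) !inE fu fv !eqxx eq_sym uv.
  lia.
case/card_gt0P => w; rewrite !inE => /and3P[wv wu /eqP fw].
have : y = w by apply: (clique_class_nbr bad fu fv fw); rewrite // eq_sym.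
by move=> E; rewrite E fw eqxx in fy.
Qed.

(** Double counting: each repeated vertex outside the triangle sends at most one thin edge into it,
    and none of the three vertices has a thin edge inside it. *)
Lemma tdeg_clique_triangle i : clique_class i -> 2 < #|cls i| ->
  \sum_(v in cls i) tdeg v + #|cls i| <= mu.
Proof.
move=> bad s3; have si : 1 < #|cls i| by case/andP: bad.
rewrite (eq_bigr _ (fun v _ => tdegE v)) exchange_big /= (bigD1 i) //=.
rewrite big1 ?add0n => [|v]; last by rewrite inE => /eqP fv; rewrite cdeg_clique.
rewrite card_repeated [leqRHS](bigD1 i) //= addnC leq_add2l.
apply: leq_sum => j /andP[sj ji].
have -> : \sum_(v in cls i) cdeg v j =
   \sum_(v in cls i) \sum_(y in cls j) (thin v y : nat).
  apply: eq_bigr => v _; rewrite /cdeg -sum1_card.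
  rewrite (eq_bigl (fun y => (y \in cls j) && thin v y)); last first.
    by move=> y; rewrite !inE.
  by rewrite big_mkcondr; apply: eq_bigr => y _; case: (thin _ _).
rewrite exchange_big /= -sum1_card; apply: leq_sum => y; rewrite inE => /eqP fy.
have := @clique_class_nbr1 i y bad s3 (ltac:(by rewrite fy)).
rewrite -sum1_card; apply: leq_trans; rewrite eq_leq //.
rewrite [RHS](eq_bigl (fun v => (v \in cls i) && thin y v)); last first.
  by move=> v; rewrite !inE.
by rewrite big_mkcondr; apply: eq_bigr => v _; rewrite thin_sym; case: (thin _ _).
Qed.

(** * Bounding the degree sum inside the repeated vertices *)

Lemma rdegE v :
  rdeg v = tdeg v + (if clique_class (f v) then #|cls (f v)|.-1 else 0).
Proof.
rewrite /rdeg /tdeg; case: ifP => [bad|nbad]; last first.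
  rewrite addn0; congr #|pred_of_set _|; apply/setP=> y.
  by rewrite !inE /thin nbad andbF andbT.
have sv : 1 < #|cls (f v)| by case/andP: bad.
rewrite -(cardsID (cls (f v))) addnC; congr (_ + _).
  congr #|pred_of_set _|; apply/setP=> y.
  by rewrite !inE /thin bad andbT (eq_sym (f v)) andbC andbA andbAC.
have -> : [set y in M | e v y] :&: cls (f v) = cls (f v) :\ v.
  apply/setP=> y; rewrite !inE andbC.
  have [fy|] := eqVneq (f y) (f v); rewrite ?andbF //= fy sv andbT /=.
  apply/idP/idP => [/e_neq|yv]; first by rewrite eq_sym.
  by apply: (clique_classP bad); rewrite // eq_sym.
by rewrite (cardsD1 v (cls (f v))) inE eqxx.
Qed.

Lemma sum_rdeg_clique i : clique_class i ->
  \sum_(v in cls i) rdeg v = \sum_(v in cls i) tdeg v + #|cls i| * #|cls i|.-1.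
Proof.
move=> bad; rewrite -sum_nat_const -big_split /=.
by apply: eq_bigr => v; rewrite inE => /eqP fv; rewrite rdegE fv bad.
Qed.

Lemma sum_rdeg_nonclique i : ~~ clique_class i ->
  \sum_(v in cls i) rdeg v = \sum_(v in cls i) tdeg v.
Proof.
move=> /negbTE nbad; apply: eq_bigr => v; rewrite inE => /eqP fv.
by rewrite rdegE fv nbad addn0.
Qed.

(** The 6 counts the ordered adjacent pairs in a triangle, the largest possible clique class. *)
Lemma sum_rdeg_le i :
  \sum_(v in cls i) rdeg v <= \sum_(v in cls i) tdeg v + 6.
Proof.
have [bad|nbad] := boolP (clique_class i); last by rewrite sum_rdeg_nonclique ?leq_addr.
rewrite sum_rdeg_clique // leq_add2l.
by case: #|_| (card_clique_class bad) => [|[|[|[|]]]].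
Qed.

Lemma rdeg_le v : rdeg v <= tdeg v + 2.
Proof.
rewrite rdegE leq_add2l; case: ifP => // /card_clique_class.
by case: #|_| => [|[|[|[|]]]].
Qed.

(** Here [g] is twice a cap on thin degrees and [t] marks the classes whose inner edges the caps do
    not absorb. In the second bound the class of [v] is treated vertex by vertex, at a cost of 12
    for its inner edges, so that the slack of the cap at [v] is kept; this later excludes repeated
    vertices of small degree. *)
Lemma cap_sum (g : T -> nat) (t : pred I) :
    (forall v, v \in M -> 2 * tdeg v <= g v) ->
    (forall i, 1 < #|cls i| ->
       2 * \sum_(v in cls i) rdeg v <= \sum_(v in cls i) g v + 4 * t i) ->
  2 * \sum_(v in M) rdeg v <=
    \sum_(v in M) g v + 4 * #|[set i | (1 < #|cls i|) && t i]|
  /\ forall v, v \in M -> 2 * \sum_(w in M) rdeg w + g v <=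
    \sum_(w in M) g w + 4 * #|[set i | (1 < #|cls i|) && t i]| + 12 + 2 * tdeg v.
Proof.
move=> hg ht.
have cardT : #|[set i | (1 < #|cls i|) && t i]| = \sum_(i | 1 < #|cls i|) t i.
  rewrite -sum1_card (eq_bigl (fun i => (1 < #|cls i|) && t i)); last first.
    by move=> i; rewrite inE.
  by rewrite big_mkcondr; apply: eq_bigr => i _; case: (t i).
rewrite !sum_repeated cardT !big_distrr /= -big_split /=; split.
  by apply: leq_sum => i; apply: ht.
move=> v vM; have sv : 1 < #|cls (f v)| by move: vM; rewrite inE.
rewrite (bigD1 (f v)) //= [in leqRHS](bigD1 (f v)) //=.
have : \sum_(i | (1 < #|cls i|) && (i != f v)) 2 * \sum_(w in cls i) rdeg w <=
  \sum_(i | (1 < #|cls i|) && (i != f v)) (\sum_(w in cls i) g w + 4 * t i).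
  by apply: leq_sum => i /andP[hi _]; apply: ht.
suff : 2 * \sum_(w in cls (f v)) tdeg w + g v <=
  \sum_(w in cls (f v)) g w + 2 * tdeg v.
  have := sum_rdeg_le (f v); lia.
have vc : v \in cls (f v) by rewrite inE.
rewrite (bigD1 v) //= [in leqRHS](bigD1 v) //=.
have : \sum_(w in cls (f v) | w != v) 2 * tdeg w <=
  \sum_(w in cls (f v) | w != v) g w.
  apply: leq_sum => w /andP[]; rewrite inE => /eqP fw _.
  by apply: hg; rewrite inE fw.
rewrite -big_distrr /=; lia.
Qed.

Lemma class_pair i : #|cls i| = 2 ->
  exists u z, [/\ u != z, f u = i, f z = i & cls i = [set u; z]].
Proof.
move=> /eqP/cards2P[u [z [uz E]]]; exists u, z; split=> //.
  by have : u \in cls i; [rewrite E !inE eqxx | rewrite inE => /eqP].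
by have : z \in cls i; [rewrite E !inE eqxx orbT | rewrite inE => /eqP].
Qed.

(* The two-element classes whose inner edge is not paid for by a deficit. *)
Definition tight_pair (x : T) (r : nat) (i : I) : bool :=
  [&& clique_class i, #|cls i| == 2, cls i \subset [set w | thin x w]
    & 2 * r <= (\sum_(v in cls i) tdeg v).+1].

(** Fix a tight pair [u], [z]. Any other tight pair lies in the neighbourhood of [x], so by
    [cdeg_thin] neither [u] nor [z] has a thin neighbour in it. Each tight pair thus costs 2 in the
    bound [mu] on [tdeg u + tdeg z], a sum which tightness keeps at [2 * r - 1] or more. *)
Lemma card_tight_pair x r : r <= tdeg x -> tdeg x + r = mu ->
  2 * #|[set i | (1 < #|cls i|) && tight_pair x r i]| + r <= (tdeg x).+1.
Proof.
move=> rD mE; set Tt := [set i | _].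
have [->|[i0]] := set_0Vmem Tt; first by rewrite cards0 muln0; lia.
rewrite inE => /andP[si0 /and4P[bad0 /eqP s0 sub0 sum0]].
have [u [z [uz fu fz E]]] := class_pair s0.
move: sum0; rewrite E big_setU1 /= ?inE // big_set1 => sum0.
have [xu xz] : thin x u /\ thin x z.
  by split; have := subsetP sub0; rewrite E => H;
     [have := H u | have := H z]; rewrite !inE eqxx ?orbT => /(_ isT).
suff : tdeg u + tdeg z + 2 * #|Tt| <= mu by lia.
have -> : #|Tt| = \sum_(i | 1 < #|cls i|) tight_pair x r i.
  rewrite -sum1_card (eq_bigl (fun i => (1 < #|cls i|) && tight_pair x r i)); last first.
    by move=> i; rewrite inE.
  by rewrite big_mkcondr; apply: eq_bigr => i _; case: (tight_pair _ _ _).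
rewrite !tdegE card_repeated big_distrr -!big_split /=; apply: leq_sum => j sj.
have [->|ji] := eqVneq j i0.
  by rewrite !cdeg_clique // s0; case: (tight_pair _ _ _).
have [|_] := boolP (tight_pair x r j); last by rewrite muln0 addn0; apply: cdeg_clique_pair ji.
case/and4P=> badj /eqP s2 subj _.
have cx : cdeg x j = 2.
  rewrite -s2 /cdeg; congr #|pred_of_set _|; apply/setP=> y; rewrite inE.
  by apply: andb_idr => /(subsetP subj); rewrite inE.
have := cdeg_thin xu sj; have := cdeg_thin xz sj; lia.
Qed.

(** Thin neighbours of [x] are capped by [r], all others by the maximum [tdeg x]. A triangle
    contains at most one thin neighbour of [x], so its caps sum to at least [mu + tdeg x], which
    covers its inner edges. *)
Lemma cap_class_vertex x r i : (forall v, tdeg v <= tdeg x) -> r <= tdeg x ->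
    tdeg x + r = mu -> 2 < tdeg x -> 1 < #|cls i| ->
  2 * \sum_(v in cls i) rdeg v <=
  \sum_(v in cls i) 2 * (if thin x v then r else tdeg x) + 4 * tight_pair x r i.
Proof.
move=> hmax rD mE D3 si; rewrite -big_distrr /=.
have cap v : tdeg v <= (if thin x v then r else tdeg x).
  by case: ifP => [/tdeg_thin|_]; [lia | apply: hmax].
have [bad|nbad] := boolP (clique_class i); last first.
  rewrite sum_rdeg_nonclique //.
  suff : \sum_(v in cls i) tdeg v <= \sum_(v in cls i) (if thin x v then r else tdeg x).
    lia.
  exact: leq_sum.
rewrite sum_rdeg_clique //.
have := card_clique_class bad; rewrite leq_eqVlt => /orP[/eqP s3|s2].
  have := tdeg_clique_triangle bad; rewrite s3 => /(_ isT) /= hs.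
  suff : mu + tdeg x <= \sum_(v in cls i) (if thin x v then r else tdeg x) by lia.
  have c1 : #|[set v in cls i | thin x v]| <= 1.
    have [fx|fx] := eqVneq (f x) i; last by apply: clique_class_nbr1; rewrite ?s3.
    by rewrite -/(cdeg x i) cdeg_clique.
  have : \sum_(v in cls i) (if thin x v then r else tdeg x) =
    #|[set v in cls i | thin x v]| * r + (3 - #|[set v in cls i | thin x v]|) * tdeg x.
    rewrite -s3 (bigID (thin x)) /=; congr (_ + _).
      rewrite -sum_nat_const; rewrite (eq_bigl (mem [set v in cls i | thin x v])).
        by apply: eq_bigr => v /setIdP[_ ->].
      by move=> v; rewrite !inE.
    rewrite -(cardsID [set v | thin x v] (cls i)).
    have -> : cls i :&: [set v | thin x v] = [set v in cls i | thin x v].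
      by apply/setP=> v; rewrite !inE.
    rewrite addKn -sum_nat_const (eq_bigl (mem (cls i :\: [set v | thin x v]))).
      by apply: eq_bigr => v /setDP[_]; rewrite inE => /negbTE->.
    by move=> v; rewrite !inE andbC.
  move=> ->; case: #|_| c1 => [|[|//]] _; lia.
have s2' : #|cls i| = 2 by lia.
have [u [z [uz fu fz E]]] := class_pair s2'.
have := tdeg_clique_pair bad fu fz uz.
have := cap u; have := cap z.
have S F : \sum_(v in cls i) F v = F u + F z :> nat.
  by rewrite E big_setU1 /= ?inE // big_set1.
rewrite !S s2' /tight_pair bad s2' eqxx S /= E.
have -> : ([set u; z] \subset [set w | thin x w]) = thin x u && thin x z.
  by rewrite subUset !sub1set !inE.
(* Unless both are neighbours of [x], the caps add up to at least [mu], and [tdeg_clique_pair]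
   suffices. If both are, either the thin degrees fall short of [2 * r] by at least 2, or the pair
   is tight. *)
case: (thin x u); case: (thin x z) => /=; lia.
Qed.

Lemma cap_class_half i : 5 < mu -> (forall v, 2 * tdeg v <= mu) ->
    1 < #|cls i| ->
  2 * \sum_(v in cls i) rdeg v <= \sum_(v in cls i) mu + 4 * false.
Proof.
move=> m6 hmax si; rewrite muln0 addn0.
have [bad|nbad] := boolP (clique_class i); last first.
  by rewrite sum_rdeg_nonclique // big_distrr /=; apply: leq_sum.
rewrite sum_rdeg_clique // sum_nat_const.
have := card_clique_class bad; rewrite leq_eqVlt => /orP[/eqP s3|s2].
  by have := tdeg_clique_triangle bad; rewrite s3 => /(_ isT) /= hs; lia.
have s2' : #|cls i| = 2 by lia.
have [u [z [uz fu fz E]]] := class_pair s2'.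
have := tdeg_clique_pair bad fu fz uz.
by rewrite s2' E big_setU1 /= ?inE // big_set1; lia.
Qed.

Lemma sum_cap_vertex x r : tdeg x + r = mu ->
  \sum_(v in M) 2 * (if thin x v then r else tdeg x) = 4 * (tdeg x * r).
Proof.
move=> mE; rewrite -big_distrr /=.
suff -> : \sum_(v in M) (if thin x v then r else tdeg x) = tdeg x * r + r * tdeg x.
  by lia.
rewrite (bigID (thin x)) /=; congr (_ + _).
  rewrite /tdeg -sum_nat_const (eq_bigl (mem [set v in M | thin x v])).
    by apply: eq_bigr => v /setIdP[_ ->].
  by move=> v; rewrite !inE.
have rE : r = #|M :\: [set v | thin x v]|.
  have := cardsID [set v | thin x v] M.
  have -> : M :&: [set v | thin x v] = [set v in M | thin x v].
    by apply/setP=> v; rewrite !inE.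
  by rewrite -/(tdeg x); lia.
rewrite [in r * _]rE -sum_nat_const (eq_bigl (mem (M :\: [set v | thin x v]))).
  by apply: eq_bigr => v /setDP[_]; rewrite inE => /negbTE->.
by move=> v; rewrite !inE andbC.
Qed.

(** If the maximal thin degree is at least [mu / 2], it serves as [D]. Otherwise every thin degree
    is capped by [mu / 2], and [D], [r] are the two halves of [mu]. The last inequality gains on the
    first when [rdeg v] is well below [r]; its 14 is 2 plus the 12 from [cap_sum]. *)
Lemma sum_rdeg_repeated : 5 < mu -> exists D r,
  [/\ D + r = mu, r <= D, forall v, tdeg v <= D,
    2 * \sum_(v in M) rdeg v + 2 * r <= 4 * (D * r) + 2 * D + 2 &
    forall v, v \in M -> 2 * \sum_(w in M) rdeg w + 4 * r <=
      4 * (D * r) + 2 * D + 14 + 2 * rdeg v].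
Proof.
move=> m6; have /card_gt0P[v0 _] : 0 < mu by lia.
have tr v : tdeg v <= rdeg v by rewrite rdegE leq_addr.
case: (@arg_maxnP _ v0 xpredT tdeg isT) => x _ hmax'.
have {hmax'} hmax v : tdeg v <= tdeg x by apply: hmax'.
have tM : tdeg x <= mu by apply/subset_leq_card/subsetP => y; rewrite inE => /andP[].
have [h|h] := leqP mu (2 * tdeg x).
  exists (tdeg x), (mu - tdeg x); set r := mu - _.
  have mE : tdeg x + r = mu by rewrite /r; lia.
  have rD : r <= tdeg x by lia.
  have D3 : 2 < tdeg x by lia.
  have [] := @cap_sum (fun v => 2 * (if thin x v then r else tdeg x)) (tight_pair x r).
  - move=> v _; case: ifP => [/tdeg_thin|_]; first lia.
    by rewrite leq_mul2l hmax.
  - by move=> i; apply: cap_class_vertex.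
  rewrite sum_cap_vertex //; have := card_tight_pair rD mE => ct S1 S2.
  split=> //; first lia.
  move=> v vM; have := S2 v vM; have := tr v.
  have : 2 * r <= 2 * (if thin x v then r else tdeg x) by case: ifP; lia.
  lia.
have [] := @cap_sum (fun v => mu) pred0.
- by move=> v _; have := hmax v; lia.
- by move=> i; apply: cap_class_half => // v; have := hmax v; lia.
have -> : [set i | (1 < #|cls i|) && pred0 i] = set0.
  by apply/setP=> i; rewrite !inE andbF.
rewrite cards0 muln0 addn0 sum_nat_const => S1 S2.
exists (uphalf mu), (mu./2).
have mE : uphalf mu + mu./2 = mu by rewrite uphalf_half -addnA addnn odd_double_half.
have D1 : mu./2 <= uphalf mu <= (mu./2).+1 by rewrite uphalf_half; case: odd; lia.
have sq : mu * mu <= 4 * (uphalf mu * mu./2) + 1.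
  by rewrite -{1 2}mE; move: D1; move: (uphalf mu) (mu./2) => a b; nia.
split=> //; first lia.
- by move=> v; have := hmax v; lia.
- lia.
- by move=> v vM; have := S2 v vM; have := tr v; lia.
Qed.

End ColouredGraph.

(** * Arithmetic *)

Lemma leq_sum_injective (T : finType) (A : {set T}) (h : T -> nat) :
  {in A &, injective h} -> #|A| * #|A|.-1 <= 2 * \sum_(v in A) h v.
Proof.
elim: {A}#|A| {-2}A (erefl #|A|) => [|k IH] A cA injA; first by rewrite cA.
have /card_gt0P[v0 v0A] : 0 < #|A| by rewrite cA.
case: (arg_maxnP h v0A) => w; rewrite -/(w \in A) => wA hmax.
have cA' : #|A :\ w| = k by move: cA; rewrite (cardsD1 w) wA => -[].
have sub : {subset A :\ w <= A} by move=> y /setD1P[].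
have hw : k <= h w.
  have inj' : {in A &, injective (fun v => inord (h v) : 'I_(h w).+1)}.
    move=> u v uA vA /(congr1 val) /=.
    by rewrite !inordK ?ltnS; [apply: injA | apply: hmax | apply: hmax].
  have := max_card (mem ((fun v => inord (h v) : 'I_(h w).+1) @: A)).
  by rewrite card_in_imset // cA card_ord.
have := IH _ cA' (fun u v hu hv => injA u v (sub _ hu) (sub _ hv)).
by rewrite cA' cA (big_setD1 w wA) /=; nia.
Qed.

Lemma leq_sum_injective_max (T : finType) (A : {set T}) (h : T -> nat) m :
  {in A &, injective h} -> {in A, forall v, h v <= m} ->
  2 * \sum_(v in A) h v + #|A| * #|A|.-1 <= 2 * (#|A| * m).
Proof.
move=> injA hm.
have inj' : {in A &, injective (fun v => m - h v)}.
  move=> u v uA vA /= E; apply: injA => //.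
  by have := hm u uA; have := hm v vA; lia.
have := leq_sum_injective inj'.
have : \sum_(v in A) (m - h v) + \sum_(v in A) h v = #|A| * m.
  by rewrite -big_split -sum_nat_const /=; apply: eq_bigr => v /hm; lia.
lia.
Qed.

Section Arithmetic.
Local Open Scope Z_scope.

(** In the sum of the two bounds [p] has the nonnegative coefficient [j + 2], so the worst case is
    [p = D]. *)
Lemma unique_part_bound (mu D k j p SKM SK : Z) :
    0 <= p <= D -> 0 <= j <= k - 1 ->
    SKM <= p + (k - 1 - j) * (mu - p) + j * D ->
    2 * SK <= 2 * k * (p + (k - 1 - j)) - k * (k - 1) ->
  2 * (SKM + SK) <=
    4 * D + 2 * (k - 1) * (mu + k) - k * (k - 1) + 2 * j * (2 * D - mu - k).
Proof.
move=> hp hj h1 h2.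
have : 0 <= (D - p) * (j + 2) by apply: Z.mul_nonneg_nonneg; lia.
lia.
Qed.

(* With [A = D - r] and [del] the deficit in the bound on [SM], comparing with
   [4 e >= (D + r + k)^2 - 1] leaves either [k + (A - 2)^2 + del <= 7] or, when
   [A > k], [k (k - 3) + (A - k) (A - k - 2) + del <= 3]. *)
Lemma small_parameters (n D r k j SM SU del : Z) :
    D + r + k = 2 * n + 1 -> 0 <= r <= D -> 0 <= j <= k - 1 -> 0 <= del ->
    2 * SM + 2 * r + del <= 4 * (D * r) + 2 * D + 2 ->
    2 * SU <= 4 * D + 2 * (k - 1) * (D + r + k) - k * (k - 1)
      + 2 * j * (2 * D - (D + r) - k) ->
    2 * n * n + 2 * n <= SM + SU ->
  [/\ k <= 7, D <= r + 7 & del <= 7].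
Proof.
move=> hN hr hj hd h1 h2 h3.
have e4 : (D + r + k) * (D + r + k) - 1 <= 2 * SM + 2 * SU by rewrite hN; lia.
have [A [Ea hA]] : exists A, D = r + A /\ 0 <= A by exists (D - r); lia.
subst D.
have [hk|hk] : A <= k \/ k < A by lia.
  have hp : j * (k - A) >= 0 by nia.
  have H : k + (A - 2) * (A - 2) + del <= 7 by lia.
  have : A - 2 <= 5 by clear - H hj hd; nia.
  have := Z.square_nonneg (A - 2).
  by split; lia.
have hp : 0 <= (k - 1 - j) * (A - k) by apply: Z.mul_nonneg_nonneg; lia.
have [y [Ey hy]] : exists y, A = k + y /\ 0 < y by exists (A - k); lia.
subst A.
have H : k * (k - 3) + y * (y - 2) + del <= 3 by lia.
have hk2 : -2 <= k * (k - 3) by clear; have [?|?] : k <= 1 \/ 2 <= k; [lia | nia..].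
have hy2 : -1 <= y * (y - 2) by have := Z.square_nonneg (y - 1); lia.
have : k <= 4 by clear - H hy2 hd; nia.
have : y <= 3 by clear - H hk2 hd; nia.
by split; lia.
Qed.

Lemma small_parameters0 (n D r SM del : Z) :
    D + r = 2 * n + 1 -> 0 <= r <= D -> 0 <= del ->
    2 * SM + 2 * r + del <= 4 * (D * r) + 2 * D + 2 ->
    2 * n * n + 2 * n <= SM ->
  D <= r + 7 /\ del <= 7.
Proof.
move=> hN hr hd h1 h3.
have e4 : (D + r) * (D + r) - 1 <= 2 * SM by rewrite hN; lia.
have [A [Ea hA]] : exists A, D = r + A /\ 0 <= A by exists (D - r); lia.
subst D.
have H : (A - 1) * (A - 1) + del <= 4 by lia.
have := Z.square_nonneg (A - 1).
have : A <= 3 by clear - H hd; nia.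
lia.
Qed.

(** Comparing with [N^2 - 1] for [N = D + r + k], the leading terms cancel and leave
    [4 * r <= 4 * rd] up to a constant, while [r] is within a constant of [n]. *)
Lemma unique_vertex_bound (n D r k SM SKM SK rd : Z) :
    D + r + k = 2 * n + 1 -> 0 <= r <= D -> D <= r + 7 -> 1 <= k <= 7 ->
    2 * SM + 2 * r <= 4 * (D * r) + 2 * D + 2 ->
    SKM <= (k - 1) * D + rd -> SK <= SKM + k * k ->
    2 * n * n + 2 * n <= SM + SKM + SK ->
  n - 30 <= rd.
Proof.
move=> hN hr hA hk h1 h2 h3 h4.
have e4 : (D + r + k) * (D + r + k) - 1 <= 2 * SM + 2 * SKM + 2 * SK by rewrite hN; lia.
have [A [Ea hA0]] : exists A, D = r + A /\ 0 <= A by exists (D - r); lia.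
subst D.
have := Z.square_nonneg (A - k).
have : k * k <= 49 by clear - hk; nia.
lia.
Qed.

(** With at most 5 repeated vertices [D] is taken to be 5. Since nearly all degrees are distinct,
    the bound on [4 e] stays about [N] below [N^2], where [N = mu + k]. *)
Lemma few_repeated_absurd (n mu k j SM SU : Z) :
    mu + k = 2 * n + 1 -> 0 <= mu <= 5 -> 600 <= n -> 0 <= j <= k - 1 ->
    SM <= 25 ->
    2 * SU <= 4 * 5 + 2 * (k - 1) * (mu + k) - k * (k - 1)
      + 2 * j * (2 * 5 - mu - k) ->
    2 * n * n + 2 * n <= SM + SU -> False.
Proof.
move=> hN hmu hn hj h1 h2 h3.
have e4 : (mu + k) * (mu + k) - 1 <= 2 * SM + 2 * SU by rewrite hN; lia.
have : 0 <= j * (mu + k - 10) by apply: Z.mul_nonneg_nonneg; lia.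
have := Z.square_nonneg mu.
lia.
Qed.
End Arithmetic.

(** * Degrees *)

Lemma set2_eq (T : finType) (a b x y : T) : a != b ->
  [set a; b] = [set x; y] -> (a, b) = (x, y) \/ (a, b) = (y, x).
Proof.
move=> ab E.
have : a \in [set x; y] by rewrite -E !inE eqxx.
have : b \in [set x; y] by rewrite -E !inE eqxx orbT.
rewrite !inE => /orP[] /eqP hb /orP[] /eqP ha; subst.
- by rewrite eqxx in ab.
- by right.
- by left.
- by rewrite eqxx in ab.
Qed.

Lemma sum_degree (G : sgraph) : \sum_(v : G) degree v = 2 * #|edges G|.
Proof.
have -> : \sum_(v : G) degree v = \sum_(p : G * G | adj p.1 p.2) 1.
  rewrite (eq_bigr (fun v => \sum_(y | adj v y) 1)).
    by rewrite pair_big_dep.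
  by move=> v _; rewrite /degree -sum1_card; apply: eq_bigl => y; rewrite inE.
rewrite (partition_big (fun p : G * G => [set p.1; p.2]) (mem (edges G))) /=.
  rewrite mulnC -sum_nat_const; apply: eq_bigr => E /imsetP[[x y]].
  rewrite inE /= => xy ->.
  have nxy : x != y by apply: contraTneq xy => ->; rewrite adj_irrefl.
  rewrite (eq_bigl (mem [set (x, y); (y, x)])).
    by rewrite sum1_card cards2 xpair_eqE (negbTE nxy).
  case=> a b /=; rewrite !inE; apply/andP/orP => /=.
    case=> ab /eqP /set2_eq [|/eqP ->|/eqP ->]; [|by left|by right].
    by apply: contraTneq ab => ->; rewrite adj_irrefl.
  case=> /eqP[-> ->]; first by [].
  by rewrite adj_sym xy setUC.
by move=> p ap; apply/imsetP; exists p; rewrite ?inE.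
Qed.

Section NoEqualDegreePath.

Variables (G : sgraph) (n : nat).
Hypothesis noP : ~ has_equal_degree_path3 G.

(** A degree is encoded as the set of vertices having it, which makes the type of colours finite. *)
Definition dcol (v : G) : {set G} := [set u | degree u == degree v].

Lemma dcol_eq u v : (dcol u == dcol v) = (degree u == degree v).
Proof.
apply/eqP/eqP => [E|E]; last by rewrite /dcol E.
by have : u \in dcol u; [rewrite inE | rewrite E inE => /eqP].
Qed.

Lemma dcol_no_path (x y a b : G) : adj x y -> adj x a -> adj y b -> a != y ->
  b != x -> dcol a = dcol b -> a = b.
Proof.
move=> xy xa yb ay bx /eqP; rewrite dcol_eq => /eqP dab.
apply/eqP/negPn/negP => ab; apply: noP; exists a, b; split=> //.
have neq (u v : G) : adj u v -> u != v.
  by apply: contraTneq => ->; rewrite adj_irrefl.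
exists x, y; split; rewrite // 1?adj_sym // /= !inE !negb_or.
by rewrite ay ab (neq _ _ xy) (neq _ _ yb) (eq_sym a x) (neq _ _ xa) (eq_sym x b) bx.
Qed.

Local Notation M := (repeated dcol).
Local Notation rd := (rdeg (@adj G) dcol).
Local Notation K := (~: repeated dcol).

Definition kdeg (v : G) : nat := #|[set y in K | adj v y]|.

Lemma degree_split v : degree v = rd v + kdeg v.
Proof.
rewrite /degree -(cardsID M); congr (_ + _); congr #|pred_of_set _|.
  by apply/setP=> y; rewrite !inE andbC.
by apply/setP=> y; rewrite !inE.
Qed.

Lemma kdeg_le v : kdeg v <= #|K|.
Proof. by apply/subset_leq_card/subsetP => y; rewrite inE => /andP[]. Qed.

Lemma sum_kdeg_rdeg : \sum_(v in M) kdeg v = \sum_(v in K) rd v.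
Proof.
have E (A : {set G}) v : #|[set y in A | adj v y]| = \sum_(y in A) adj v y.
  rewrite -sum1_card (eq_bigl (fun y => (y \in A) && adj v y)).
    by rewrite big_mkcondr; apply: eq_bigr => y _; case: (adj _ _).
  by move=> y; rewrite !inE.
rewrite (eq_bigr _ (fun v _ => E K v)) exchange_big /=.
apply: eq_bigr => y _; rewrite /rdeg E.
by apply: eq_bigr => v _; rewrite adj_sym.
Qed.

Lemma sum_degree_split :
  \sum_(v : G) degree v =
  \sum_(v in M) rd v + \sum_(v in K) rd v + \sum_(v in K) degree v.
Proof.
rewrite (bigID (mem M)) /= -sum_kdeg_rdeg -big_split /=; congr (_ + _).
  by apply: eq_bigr => v _; apply: degree_split.
by apply: eq_bigl => v; rewrite in_setC.
Qed.

(** * Vertices of unique degree *)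

Lemma degree_inj_unique : {in K &, injective (@degree G)}.
Proof.
move=> u v; rewrite !inE -leqNgt => hu _ duv.
by apply: (card_le1_eqP hu); rewrite !inE // dcol_eq duv.
Qed.

Lemma rdeg_unique v : v \in K -> rd v = tdeg (@adj G) dcol v.
Proof.
rewrite !inE -leqNgt => hv.
rewrite rdegE; last exact: adj_irrefl.
rewrite /clique_class ltnNge hv /=.
by rewrite addn0.
Qed.

(** A one-element class is not a clique class, so every edge inside [K] is thin. *)
Lemma rdeg_unique_edge u w : u \in K -> w \in K -> adj u w ->
  rd u + rd w <= #|M|.
Proof.
move=> uK wK uw; rewrite !rdeg_unique //.
apply: (tdeg_thin (@adj_sym G) (@adj_irrefl G) dcol_no_path).
move: uK; rewrite !inE -leqNgt /thin uw /clique_class ltnNge => -> /=.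
by rewrite andbF.
Qed.

(** For [w] of maximal degree in [K], [p] counts its neighbours in [M] and [j] its non-neighbours in
    [K] other than [w]. A neighbour of [w] in [K] has at most [#|M| - p] neighbours in [M], a
    non-neighbour at most [D]; all degrees in [K] are distinct and at most that of [w]. *)
Lemma unique_part D : 0 < #|K| -> {in K, forall v, rd v <= D} ->
  exists p j, [/\ p <= D, j < #|K|, p <= #|M|,
    \sum_(v in K) rd v <= p + (#|K|.-1 - j) * (#|M| - p) + j * D &
    2 * \sum_(v in K) degree v + #|K| * #|K|.-1 <=
      2 * (#|K| * (p + (#|K|.-1 - j)))].
Proof.
move=> /card_gt0P[v0 v0K] hD.
case: (arg_maxnP (@degree G) v0K) => w; rewrite -/(w \in K) => wK hmax.
have kw : kdeg w < #|K|.
  rewrite (cardsD1 w K) wK add1n ltnS; apply/subset_leq_card/subsetP => y.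
  rewrite !inE => /andP[->]; rewrite andbT.
  by apply: contraTneq => ->; rewrite adj_irrefl.
have kw' : kdeg w <= #|K|.-1 by rewrite -ltnS (ltn_predK kw).
have pM : rd w <= #|M| by apply/subset_leq_card/subsetP => y; rewrite inE => /andP[].
exists (rd w), (#|K|.-1 - kdeg w); split=> //.
- exact: hD.
- by rewrite (leq_ltn_trans (leq_subr _ _)) // ltn_predL (leq_ltn_trans _ kw).
- rewrite (bigD1 w wK) /= -addnA leq_add2l (bigID (adj w)) /=.
  have kE : kdeg w = #|[set v in K | (v != w) && adj w v]|.
    congr #|pred_of_set _|; apply/setP=> y; rewrite !inE; congr (_ && _).
    rewrite andbC; symmetry; apply: andb_idr.
    by apply: contraTneq => ->; rewrite adj_irrefl.
  rewrite subKn //.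
  apply: leq_add.
    rewrite kE -sum_nat_const [leqRHS](eq_bigl (fun v => (v \in K) && (v != w) && adj w v)).
      apply: leq_sum => v /andP[/andP[vK _] wv].
      by have := rdeg_unique_edge wK vK wv; lia.
    by move=> v; rewrite !inE andbA.
  have -> : #|K|.-1 - kdeg w = #|[set v in K | (v != w) && ~~ adj w v]|.
    rewrite (cardsD1 w K) wK add1n /= -(cardsID [set v | adj w v] (K :\ w)).
    have -> : (K :\ w) :&: [set v | adj w v] = [set v in K | (v != w) && adj w v].
      by apply/setP=> v; rewrite !inE; case: (v == w); rewrite //= andbF.
    rewrite -kE addKn; congr #|pred_of_set _|; apply/setP=> v; rewrite !inE.
    by case: (v == w); case: (adj w v); rewrite ?andbF ?andbT.
  rewrite -sum_nat_const [leqRHS](eq_bigl (fun v => (v \in K) && (v != w) && ~~ adj w v)).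
    by apply: leq_sum => v /andP[/andP[vK _] _]; apply: hD.
  by move=> v; rewrite !inE andbA.
- have := leq_sum_injective_max degree_inj_unique (hmax : {in K, forall v, _}).
rewrite subKn //.
by rewrite -degree_split.
Qed.

Lemma unique_part_sum D : 0 < #|K| -> {in K, forall v, rd v <= D} ->
  exists2 j : Z, (0 <= j <= Z.of_nat #|K| - 1)%Z &
  (2 * Z.of_nat (\sum_(v in K) rd v + \sum_(v in K) degree v) <=
   4 * Z.of_nat D + 2 * (Z.of_nat #|K| - 1) * (Z.of_nat #|M| + Z.of_nat #|K|)
   - Z.of_nat #|K| * (Z.of_nat #|K| - 1)
   + 2 * j * (2 * Z.of_nat D - Z.of_nat #|M| - Z.of_nat #|K|))%Z.
Proof.
move=> k0 hD; have [p [j [pD jk pM]]] := unique_part k0 hD.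
move: (#|K|) (#|M|) (\sum_(v in K) rd v) (\sum_(v in K) degree v) k0 jk pM.
move=> k m s1 s2 k0 jk pM h1 h2.
have Eq : Z.of_nat (k.-1 - j) = (Z.of_nat k - 1 - Z.of_nat j)%Z by lia.
have Em : Z.of_nat (m - p) = (Z.of_nat m - Z.of_nat p)%Z by lia.
have Ek : Z.of_nat k.-1 = (Z.of_nat k - 1)%Z by lia.
exists (Z.of_nat j); first lia.
rewrite Nat2Z.inj_add.
apply: (@unique_part_bound _ _ _ _ (Z.of_nat p)); rewrite -?Eq -?Em -?Ek; lia.
Qed.

(** * Near-regularity and the absence of triangles *)

Lemma near_regular : 600 <= n -> #|G| = 2 * n + 1 -> n ^ 2 + n <= #|edges G| ->
  forall v : G, n <= degree v + 30 /\ degree v <= n + 13.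
Proof.
move=> n600 cG eG.
have cMK : #|M| + #|K| = 2 * n + 1 by rewrite -cG cardsC.
have tot := sum_degree_split; rewrite sum_degree in tot.
set SM := \sum_(v in M) rd v in tot; set SKM := \sum_(v in K) rd v in tot.
set SK := \sum_(v in K) degree v in tot.
have e2 : 2 * (n * n) + 2 * n <= SM + SKM + SK by move: eG; rewrite -mulnn; lia.
have rM v : rd v <= #|M| by apply/subset_leq_card/subsetP => y; rewrite inE => /andP[].
have [m5|m6] := leqP #|M| 5.
  exfalso.
  have [||j hj SU] := @unique_part_sum 5; first lia.
    by move=> v _; apply: leq_trans m5.
  have SM25 : SM <= 25.
    apply: (@leq_trans (\sum_(v in M) 5)); last by rewrite sum_nat_const; lia.
    by apply: leq_sum => v _; apply: leq_trans m5.
  apply: (@few_repeated_absurd (Z.of_nat n) (Z.of_nat #|M|) (Z.of_nat #|K|)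
    j (Z.of_nat SM) (Z.of_nat (SKM + SK))); lia.
have [D [r [mE rD tD S1 S2]]] :=
  sum_rdeg_repeated (@adj_sym G) (@adj_irrefl G) dcol_no_path m6.
rewrite -/SM in S1.
have KD : {in K, forall v, rd v <= D} by move=> v /rdeg_unique ->.
(* The edge count leaves room for a deficit of at most 7 in the bound on [SM]. *)
have small del : 2 * SM + 2 * r + del <= 4 * (D * r) + 2 * D + 2 ->
    [/\ #|K| <= 7, D <= r + 7 & del <= 7].
  move=> hdel; have [K0|Kp] := posnP #|K|.
    have SKM0 : SKM = 0.
      by move/eqP: K0; rewrite cards_eq0 => /eqP K0; rewrite /SKM K0 big_set0.
    have SK0 : SK = 0.
      by move/eqP: K0; rewrite cards_eq0 => /eqP K0; rewrite /SK K0 big_set0.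
    have [] := @small_parameters0 (Z.of_nat n) (Z.of_nat D) (Z.of_nat r)
      (Z.of_nat SM) (Z.of_nat del); try lia.
    by split; lia.
  have [j hj SU] := unique_part_sum Kp KD.
  rewrite -mE Nat2Z.inj_add in SU.
  have [] := @small_parameters (Z.of_nat n) (Z.of_nat D) (Z.of_nat r) (Z.of_nat #|K|)
    j (Z.of_nat SM) (Z.of_nat (SKM + SK)) (Z.of_nat del); try lia.
  by split; lia.
have [|K7 A7 _] := small 0; first lia.
move=> v; have := kdeg_le v; rewrite degree_split => kv.
have tv := tD v; have rtv := rdeg_le (@adj_irrefl G) dcol_no_path v.
split; last lia.
suff : n <= rd v + 30 by lia.
have [vM|vK] := boolP (v \in M).
  have := S2 v vM; rewrite -/SM => Sv.
  have [|hr] := leqP r (rd v + 10); first lia.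
  (* If [rd v + 10 < r], the bound at [v] has a deficit of at least 10. *)
  have [|_ _] := small (2 * (r - rd v) - 12); lia.
have {}vK : v \in K by rewrite inE.
have k1 : 0 < #|K| by apply/card_gt0P; exists v.
have b1 : SKM <= (#|K|.-1) * D + rd v.
  rewrite /SKM (bigD1 v vK) /= addnC leq_add2r (cardsD1 v K) vK add1n /= -sum_nat_const.
  rewrite [leqRHS](eq_bigl (fun w => (w \in K) && (w != v))).
    by apply: leq_sum => w /andP[wK _]; apply: KD.
  by move=> w; rewrite !inE andbC.
have b2 : SK <= SKM + #|K| * #|K|.
  rewrite -sum_nat_const -big_split /=; apply: leq_sum => w _.
  by rewrite degree_split leq_add2l kdeg_le.
have := @unique_vertex_bound (Z.of_nat n) (Z.of_nat D) (Z.of_nat r) (Z.of_nat #|K|)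
  (Z.of_nat SM) (Z.of_nat SKM) (Z.of_nat SK) (Z.of_nat (rd v)).
have <- : Z.of_nat #|K|.-1 = (Z.of_nat #|K| - 1)%Z by lia.
lia.
Qed.

(** Two common neighbours of equal degree would be joined by a path through [x] and [y], so their
    degrees are distinct values between [L] and [U]. *)
Lemma codegree_le L U (x y : G) : (forall v : G, L <= degree v <= U) ->
  adj x y -> #|[set z | adj x z & adj y z]| <= U - L + 1.
Proof.
move=> hLU xy; set C := [set z | _ & _].
have inj : {in C &, injective (fun z => inord (degree z - L) : 'I_(U - L).+1)}.
  move=> a b; rewrite !inE => /andP[xa ya] /andP[xb yb] /(congr1 val) /=.
  have := hLU a; have := hLU b => hb ha.
  rewrite !inordK; try lia; move=> E.
  have neq (u v : G) : adj u v -> v != u.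
    by apply: contraTneq => ->; rewrite adj_irrefl.
  apply: (dcol_no_path xy xa yb (neq _ _ ya) (neq _ _ xb)).
  by apply/eqP; rewrite dcol_eq; apply/eqP; lia.
have := max_card (mem ((fun z => inord (degree z - L) : 'I_(U - L).+1) @: C)).
by rewrite card_in_imset // card_ord addn1.
Qed.

Lemma triangle_free : 600 <= n -> #|G| = 2 * n + 1 -> n ^ 2 + n <= #|edges G| ->
  forall x y z : G, adj x y -> adj y z -> adj x z -> False.
Proof.
move=> n600 cG eG x y z xy yz xz.
have reg := near_regular n600 cG eG.
have hLU (v : G) : n - 30 <= degree v <= n + 13 by have := reg v; lia.
have := codegree_le hLU xy; have := codegree_le hLU yz; have := codegree_le hLU xz.
have := hLU x; have := hLU y; have := hLU z.
rewrite /degree; set X := [set w | adj x w]; set Y := [set w | adj y w].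
set Z := [set w | adj z w].
have E (a b : G) : [set w | adj a w & adj b w] = [set w | adj a w] :&: [set w | adj b w].
  by apply/setP=> w; rewrite !inE.
rewrite !E -/X -/Y -/Z.
(* The pairwise intersections have at most 44 elements, so the union has at least
   [3 * (n - 30) - 3 * 44] vertices, more than [2 * n + 1] once [n > 223]. *)
have : #|X :|: Y :|: Z| <= 2 * n + 1 by rewrite -cG; apply: max_card.
have := cardsUI X Y; have := cardsUI (X :|: Y) Z.
have : #|(X :|: Y) :&: Z| <= #|X :&: Z| + #|Y :&: Z|.
  by rewrite setIUl cardsU leq_subr.
lia.
Qed.

End NoEqualDegreePath.

(** * Complete bipartite graphs *)

Lemma isomorphic_complete_bipartite (G : sgraph) (P : {set G}) m n :
  #|~: P| = m -> #|P| = n -> 0 < m -> 0 < n ->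
  (forall u v : G, adj u v = (u \in P) (+) (v \in P)) ->
  isomorphic G (complete_bipartite m n).
Proof.
move=> cQ cP m0 n0 hadj.
have /card_gt0P[q0 hq] : 0 < #|~: P| by rewrite cQ.
have /card_gt0P[p0 hp] : 0 < #|P| by rewrite cP.
pose f v : 'I_m + 'I_n :=
  if v \in P then inr (cast_ord cP (enum_rank_in hp v))
  else inl (cast_ord cQ (enum_rank_in hq v)).
have injf : injective f.
  move=> u v; rewrite /f; have [uP|uP] := boolP (u \in P);
    have [vP|vP] := boolP (v \in P) => // -[] /val_inj.
  - exact: enum_rank_in_inj.
  - by apply: enum_rank_in_inj; rewrite inE.
exists f.
  apply: (inj_card_bij injf).
  by rewrite card_sum !card_ord -cQ -cP addnC cardsC.
move=> u v; rewrite hadj /f.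
by case: (u \in P); case: (v \in P).
Qed.

(** Neighbours of a vertex [x] of maximal degree are capped by [2 * n + 1 - degree x], the others by
    [degree x]. The caps sum to at most [2 * (n ^ 2 + n)], so every cap is attained, and this
    determines all neighbourhoods. *)
Lemma mantel_extremal (G : sgraph) n : 0 < n -> #|G| = 2 * n + 1 ->
  n ^ 2 + n <= #|edges G| ->
  (forall x y z : G, adj x y -> adj y z -> adj x z -> False) ->
  isomorphic G (complete_bipartite n n.+1).
Proof.
move=> n0 cG eG trf.
have /card_gt0P[v0 _] : 0 < #|G| by lia.
case: (@arg_maxnP _ v0 xpredT (@degree G) isT) => x _ hmax'.
have {hmax'} hmax (v : G) : degree v <= degree x by apply: hmax'.
pose P := [set y | adj x y].
have PE : #|P| = degree x by [].
have QE : #|~: P| = 2 * n + 1 - degree x by rewrite -cG -PE -(cardsC P) addKn.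
have Dle : degree x <= 2 * n + 1 by rewrite -cG; apply: max_card.
have hedge (u w : G) : adj u w -> degree u + degree w <= 2 * n + 1.
  move=> uw; rewrite -cG /degree -cardsUI.
  have -> : [set y | adj u y] :&: [set y | adj w y] = set0.
    apply/setP=> y; rewrite !inE; apply/negP => /andP[uy wy].
    exact: trf uw wy uy.
  by rewrite cards0 addn0; apply: max_card.
pose cap v := if v \in P then 2 * n + 1 - degree x else degree x.
have hcap v : degree v <= cap v.
  rewrite /cap; case: ifP => [|_]; last exact: hmax.
  by rewrite inE => /hedge; lia.
have capE : \sum_v cap v = 2 * (degree x * (2 * n + 1 - degree x)).
  rewrite (bigID (mem P)) /=.
  rewrite (eq_bigr (fun=> 2 * n + 1 - degree x)); last by move=> v vP; rewrite /cap vP.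
  rewrite [X in _ + X](eq_bigr (fun=> degree x)); last first.
    by move=> v vP; rewrite /cap (negbTE vP).
  rewrite sum_nat_const PE [X in _ + X](eq_bigl (fun v => v \in ~: P)).
    by rewrite sum_nat_const QE; lia.
  by move=> v; rewrite in_setC.
have sumE := sum_degree G.
have sum_le : \sum_v cap v <= 2 * (n ^ 2 + n).
  rewrite capE -mulnn; move: (degree x) Dle => d hd.
  by have [h|h] := leqP d n; nia.
have tight v : degree v = cap v.
  apply/eqP; rewrite eqn_leq hcap leqNgt; apply/negP => hlt.
  have : \sum_(w : G) degree w < \sum_w cap w.
    rewrite (bigD1 v) //= [leqRHS](bigD1 v) //= -addSn leq_add //.
    by apply: leq_sum => w _; apply: hcap.
  lia.
have capge : 2 * (n ^ 2 + n) <= \sum_v cap v.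
  by rewrite -(eq_bigr _ (fun v _ => tight v)); lia.
have hD : degree x = n \/ degree x = n.+1.
  move: capge; rewrite capE -mulnn; move: (degree x) Dle => d hd.
  have [h|h] := leqP d n => E.
    by left; have [t Et] : exists t, n = d + t by [exists (n - d); lia]; subst n; nia.
  right; have [t Et] : exists t, d = n.+1 + t by [exists (d - n.+1); lia].
  by subst d; nia.
(* If [degree x] were [n], its neighbours would have degree [n.+1], above the maximum. *)
have {}hD : degree x = n.+1.
  case: hD => // hD.
  have /card_gt0P[p pP] : 0 < #|P| by rewrite PE hD.
  have := tight p; rewrite /cap pP; have := hmax p; lia.
have adjP p : p \in P -> [set y | adj p y] = ~: P.
  move=> pP; apply/eqP; rewrite eqEcard QE -/(degree p) (tight p) /cap pP leqnn andbT.
  apply/subsetP=> y; rewrite !inE => py; apply/negP => xy.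
  by move: pP; rewrite inE => xp; apply: trf xp py xy.
have adjQ q : q \notin P -> [set y | adj q y] = P.
  move=> qP; symmetry; apply/eqP; rewrite eqEcard PE -/(degree q) (tight q) /cap (negbTE qP).
  rewrite leqnn andbT; apply/subsetP=> p pP; rewrite inE adj_sym.
  by have : q \in [set y | adj p y]; [rewrite adjP // inE | rewrite inE].
apply: (@isomorphic_complete_bipartite _ P) => //; try lia.
move=> u v; have [uP|uP] := boolP (u \in P).
  by have/setP/(_ v) := adjP u uP; rewrite inE in_setC => ->.
by have/setP/(_ v) := adjQ u uP; rewrite inE => ->.
Qed.

Lemma degree_complete_bipartite m n (z : complete_bipartite m n) :
  degree z = if z is inl _ then n else m.
Proof.
rewrite /degree -sum1_card (eq_bigl (adj z)) => [|y]; last by rewrite inE.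
rewrite big_mkcond big_sumType /=.
by case: z => i /=; rewrite !sum_nat_const !card_ord !(muln0, muln1) ?addn0.
Qed.

Lemma isomorphic_degree (G H : sgraph) (f : G -> H) : bijective f ->
  (forall x y : G, adj (f x) (f y) = adj x y) ->
  forall x, degree (f x) = degree x.
Proof.
move=> bf hf x; rewrite /degree -(on_card_preimset (f := f)).
  by congr #|pred_of_set _|; apply/setP=> y; rewrite !inE hf.
exact: onW_bij.
Qed.

Lemma isomorphic_edges (G H : sgraph) : isomorphic G H -> #|edges G| = #|edges H|.
Proof.
case=> f bf hf; apply/eqP; rewrite -(@eqn_pmul2l 2) // -!sum_degree.
rewrite (reindex f) /=; last exact: onW_bij.
by apply/eqP/eq_bigr => x _; rewrite isomorphic_degree.
Qed.

Lemma card_edges_complete_bipartite m n : #|edges (complete_bipartite m n)| = m * n.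
Proof.
apply/eqP; rewrite -(@eqn_pmul2l 2) // -sum_degree.
rewrite (eq_bigr _ (fun z _ => degree_complete_bipartite z)) big_sumType /=.
by rewrite !sum_nat_const !card_ord; lia.
Qed.

Theorem theorem1p2 (n : nat) (hn : 600 <= n) (G : sgraph)
    (hG : #|G| = 2 * n + 1) :
  (n ^ 2 + n <= #|edges G| /\ ~ has_equal_degree_path3 G) <->
  isomorphic G (complete_bipartite n n.+1).
Proof.
split=> [[eG noP]|iso].
  apply: mantel_extremal (triangle_free noP hn hG eG) => //; lia.
split; first by rewrite (isomorphic_edges iso) card_edges_complete_bipartite -mulnn; lia.
case: iso => f bf hf [x [y [dxy [a [b [_ xa ab by_]]]]]].
move: dxy; rewrite -!(isomorphic_degree bf hf) !degree_complete_bipartite.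
move: xa ab by_; rewrite -!hf.
(* A path with three edges ends on the side opposite to its start, and the two sides have degrees
   [n] and [n.+1]. *)
by case: (f x) => ?; case: (f a) => ? //; case: (f b) => ? //; case: (f y) => ? // _ _ _; lia.
Qed.
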